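(* Let $m\ge 1$ and $n\ge 3$ be integers and let $G$ be the armed crown graph with path $P_m$ and cycle $C_n$. Then $$\alpha(G)+\alpha(L(G))=\begin{cases} \left\lfloor\dfrac{n}{2}\right\rfloor\left(\dfrac{m+1}{2}+1\right)+\dfrac{m-1}{2}\left(n+\left\lceil\dfrac{n}{2}\right\rceil\right) & \text{if } m \text{ and } n \text{ are both odd},\\[3mm] mn & \text{otherwise},\end{cases}$$ and $$\alpha(G)\cdot\alpha(L(G))=\begin{cases} \left(\left\lfloor\dfrac{n}{2}\right\rfloor\dfrac{m+1}{2}+\left\lceil\dfrac{n}{2}\right\rceil\dfrac{m-1}{2}\right)\left(\left\lfloor\dfrac{n}{2}\right\rfloor+n\,\dfrac{m-1}{2}\right) & \text{if } m \text{ and } n \text{ are both odd},\\[3mm] \dfrac{n^2m^2}{4} & \text{otherwise}.\end{cases}$$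
   Context: The armed crown with path $P_m$ and cycle $C_n$ is the graph obtained by adjoining a path $P_m$ to every vertex of the cycle $C_n$. Explicitly: let $u_1,\ldots,u_n$ be the vertices of $C_n$; for each $1\le i\le n$ take a path with vertices $u_i^1,u_i^2,\ldots,u_i^m$ (in this order) and identify its end vertex $u_i^m$ with $u_i$; the paths for different $i$ are disjoint, so $G$ has $mn$ vertices. For a graph $G$, $\alpha(G)$ denotes its independence number, i.e. the maximum cardinality of a set of pairwise non-adjacent vertices of $G$. $L(G)$ denotes the line graph of $G$: its vertices are in one-to-one correspondence with the edges of $G$, and two vertices of $L(G)$ are adjacent if and only if the corresponding edges of $G$ are adjacent (share an endpoint). *)

(* Defs.v *)
From mathcomp Require Import all_boot.

Set Implicit Arguments.
Unset Strict Implicit.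
Unset Printing Implicit Defensive.

Record sgraph := SGraph {
  vertex :> finType;
  adj : rel vertex;
  adj_sym : symmetric adj;
  adj_irrefl : irreflexive adj
}.

Definition independent (G : sgraph) (S : {set G}) : bool :=
  [forall x in S, forall y in S, ~~ adj x y].

Definition alpha (G : sgraph) : nat :=
  \max_(S : {set G} | independent S) #|S|.

Definition edges (G : sgraph) : {set {set G}} :=
  [set e | [exists x : G, exists y : G, adj x y && (e == [set x; y])]].

Definition line_vertex (G : sgraph) : finType := {e : {set G} | e \in edges G}.

Definition line_adj (G : sgraph) : rel (line_vertex G) :=
  fun e f => (e != f) && (val e :&: val f != set0).

Lemma line_adj_sym (G : sgraph) : symmetric (@line_adj G).
Proof. by move=> e f; rewrite /line_adj eq_sym setIC. Qed.

Lemma line_adj_irrefl (G : sgraph) : irreflexive (@line_adj G).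
Proof. by move=> e; rewrite /line_adj eqxx. Qed.

Definition line_graph (G : sgraph) : sgraph :=
  SGraph (@line_adj_sym G) (@line_adj_irrefl G).

Definition path_adj (m : nat) : rel 'I_m :=
  fun j k => (j.+1 == k :> nat) || (k.+1 == j :> nat).

(* [ordS] is the successor modulo n.  The conjunct [i != k] only matters for
   n = 1, where it removes the loop; for n >= 3 this is the cycle C_n. *)
Definition cycle_adj (n : nat) : rel 'I_n :=
  fun i k => (i != k) && ((k == ordS i) || (i == ordS k)).

(* The pair (i, j) stands for u_{i+1}^{j+1}: position j on the path attached
   at the i-th cycle vertex.  The cycle vertices are the path ends j = m - 1. *)
Definition crown_adj (m n : nat) : rel ('I_n * 'I_m)%type :=
  fun u v =>
    ((u.1 == v.1) && path_adj u.2 v.2)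
    || [&& u.2.+1 == m, v.2.+1 == m & cycle_adj u.1 v.1].

Lemma crown_adj_sym (m n : nat) : symmetric (@crown_adj m n).
Proof.
move=> [i j] [k l]; rewrite /crown_adj /path_adj /cycle_adj /=.
rewrite (eq_sym i k) (orbC (j.+1 == l :> nat)) (orbC (k == ordS i)).
by rewrite andbCA.
Qed.

Lemma crown_adj_irrefl (m n : nat) : irreflexive (@crown_adj m n).
Proof.
move=> [i j]; rewrite /crown_adj /path_adj /cycle_adj /= !eqxx /= !andbF.
by rewrite orbb orbF eqn_leq ltnn.
Qed.

Definition armed_crown (m n : nat) : sgraph :=
  SGraph (@crown_adj_sym m n) (@crown_adj_irrefl m n).

(* Main.v *)
Require Import Defs.
From mathcomp Require Import all_boot all_order all_algebra.
From mathcomp Require Import zify ring.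

(** Both numbers equal floor(mn/2).  If an injective self-map phi of the vertices
    of a graph sends every vertex to a neighbour, then an independent set S is
    disjoint from its image, and the edges {v, phi v} for v in S are pairwise
    disjoint: hence alpha(G) <= alpha(L(G)), which is at most |V|/2 because an
    independent set of L(G) is a matching of G.  In the crown, phi
    pairs off each path from its free end and, when m is odd, rotates the
    remaining cycle; a chequerboard set then attains floor(mn/2). *)

Set Implicit Arguments.
Unset Strict Implicit.
Unset Printing Implicit Defensive.

Lemma leq_card_alpha (G : sgraph) (S : {set G}) :
  independent S -> (#|S| <= alpha G)%N.
Proof. by move=> indS; rewrite /alpha (bigmax_sup S). Qed.

Lemma independentP (G : sgraph) (S : {set G}) :
  reflect {in S &, forall x y, ~~ adj x y} (independent S).
Proof.
apply: (iffP forall_inP) => [H x y xS yS | H x xS].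
  exact: (forall_inP (H x xS)).
by apply/forall_inP => y yS; apply: H.
Qed.

Lemma edge_mem (G : sgraph) (x y : G) : adj x y -> [set x; y] \in edges G.
Proof.
by move=> xy; rewrite inE; apply/existsP; exists x; apply/existsP; exists y;
  rewrite xy eqxx.
Qed.

Lemma card_edge (G : sgraph) (e : {set G}) : e \in edges G -> #|e| = 2.
Proof.
rewrite inE => /existsP[x /existsP[y /andP[xy /eqP->]]].
by rewrite cards2; case: eqP xy => // ->; rewrite adj_irrefl.
Qed.

Lemma alpha_line_graph_le (G : sgraph) : (alpha (line_graph G) <= #|G|./2)%N.
Proof.
apply/bigmax_leqP => M /independentP indM.
have injval : injective (val : line_vertex G -> {set G}) by exact: val_inj.
pose P : {set {set G}} := [set val (e : line_vertex G) | e in M].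
have cardP : #|P| = #|M| by rewrite card_imset.
have trivP : trivIset P.
  (* Two distinct edges of [M] with a common endpoint would be adjacent in the line graph. *)
  apply/trivIsetP => _ _ /imsetP[e eM ->] /imsetP[f fM ->] ef.
  have := indM e f eM fM; rewrite /= /line_adj -setI_eq0.
  by rewrite (contraNneq _ ef) ?negbK //= => ->.
have cov : #|cover P| = (#|M| * 2)%N.
  rewrite -(eqP trivP) (eq_bigr (fun=> 2)) ?sum_nat_const ?cardP //.
  by move=> _ /imsetP[e _ ->]; apply: card_edge (valP e).
by rewrite geq_half_double -muln2 -cov max_card.
Qed.

Lemma alpha_le_line_graph (G : sgraph) (phi : G -> G) :
  injective phi -> (forall v, adj v (phi v)) ->
  (alpha G <= alpha (line_graph G))%N.
Proof.
move=> phi_inj phi_adj; apply/bigmax_leqP => S /independentP indS.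
pose edge v : line_graph G := Sub [set v; phi v] (edge_mem (phi_adj v)).
have notphi v w : v \in S -> w \in S -> v != phi w.
  move=> vS wS; apply: contraNneq (indS w v wS vS) => ->; exact: phi_adj.
have meet v w : v \in S -> w \in S ->
    val (edge v) :&: val (edge w) != set0 -> v = w.
  move=> vS wS /set0Pn[x]; rewrite !inE.
  (* A common endpoint leaves four cases: [v = w]; the two mixed ones, excluded by [notphi]; and
     [phi v = phi w], settled by injectivity. *)
  case/andP => /orP[]/eqP-> /orP[]/eqP // => [/eqP|/eqP|/phi_inj //].
    by rewrite (negPf (notphi v w vS wS)).
  by rewrite eq_sym (negPf (notphi w v wS vS)).
have edge_inj : {in S &, injective edge}.
  move=> v w vS wS vw; apply: meet => //; rewrite vw setIid.
  by apply/set0Pn; exists w; rewrite !inE eqxx.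
rewrite -(card_in_imset edge_inj); apply: leq_card_alpha.
apply/independentP => _ _ /imsetP[v vS ->] /imsetP[w wS ->].
rewrite /= /line_adj; apply/negP => /andP[/eqP vw ne]; apply: vw.
by rewrite (meet v w vS wS ne).
Qed.

(** Swaps 2k and 2k+1, counting from the free end 0; for odd [m] the cycle position m - 1 stays
    fixed and is left to the rotation. *)
Definition path_mate (m j : nat) : nat :=
  if odd j then j.-1 else if (j.+1 < m)%N then j.+1 else j.

Lemma path_mate_lt m (j : 'I_m) : (path_mate m j < m)%N.
Proof. by rewrite /path_mate; have := ltn_ord j; do ![case: ifP]; lia. Qed.

Definition crown_mate (m n : nat) (u : 'I_n * 'I_m) : 'I_n * 'I_m :=
  (if ~~ odd u.2 && (u.2.+1 == m) then ordS u.1 else u.1,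
   Ordinal (path_mate_lt u.2)).

(** [path_mate] is injective on positions, so both vertices take the same branch in the first
    coordinate, where [ordS] is injective. *)
Lemma crown_mate_inj m n : injective (@crown_mate m n).
Proof.
move=> [i j] [k l] [] ik /= jl.
have {}jl : j = l.
  apply: val_inj; move: jl; rewrite /path_mate /=.
  by have := ltn_ord j; have := ltn_ord l; do ![case: ifP]; lia.
by move: ik; rewrite jl /=; case: ifP => _ => [/ordS_inj|] ->.
Qed.

Lemma crown_mate_adj m n (u : armed_crown m n) :
  (1 < n)%N -> adj u (crown_mate u : armed_crown m n).
Proof.
move=> n1; case: u => i j; rewrite /= /crown_adj /path_adj /cycle_adj /=.
have ltj := ltn_ord j; rewrite /path_mate.
case: ifP => [/andP[oj /eqP jm]|nlast].
  rewrite (negPf oj) jm ltnn jm !eqxx /= andbT; apply/orP; right.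
  (* What remains is [i != ordS i]: a fixed point of the successor would have to wrap to 0, forcing
     n = 1. *)
  apply/eqP => /(congr1 val) /= E; have := ltn_ord i.
  rewrite leq_eqVlt => /orP[/eqP lasti | lti].
    by move: E; rewrite lasti modnn; lia.
  by move: E; rewrite modn_small //; lia.
rewrite eqxx /=; apply/orP; left.
by case: ifP nlast => oj nlast; [|case: ifP]; lia.
Qed.

(** Used twice in counting the chequerboard: along one path, with the offset [a] as starting parity,
    and over the cycle indices with [a] = 0. *)
Lemma sum_odd a m : (\sum_(j < m) odd (a + j) = (m + odd a)./2)%N.
Proof.
elim: m => [|m IHm]; first by rewrite big_ord0; case: odd.
by rewrite big_ord_recr /= IHm; lia.
Qed.

(* For m even the cycle vertices (j = m - 1) are all left out; for m odd only
   those with i odd are taken, which is safe across the wrap-around since 0 is even. *)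
Definition chequers (m n : nat) : {set armed_crown m n} :=
  [set u : 'I_n * 'I_m | odd ((if odd m then u.1 : nat else 1) + u.2)].

Lemma chequers_independent m n : independent (chequers m n).
Proof.
apply/independentP => -[i j] [k l]; rewrite !inE /= => Sij Skl.
rewrite /crown_adj /path_adj /cycle_adj /=.
apply/negP => /orP[/andP[/eqP ik /orP[]/eqP jl]|].
- by move: Sij Skl; rewrite ik -jl; lia.
- by move: Sij Skl; rewrite ik -jl; lia.
case/and3P => /eqP jm /eqP lm /andP[_ cyc].
move: Sij Skl; case: ifP => om oi ok; last by lia.
have {}oi : odd i by lia.
have {}ok : odd k by lia.
(* The successor of an odd index is even: x + 1, or 0 at the wrap-around. *)
have succ (x y : 'I_n) : odd x -> odd y -> y <> ordS x.
  move=> ox oy /(congr1 val) /= E; have := ltn_ord x.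
  rewrite leq_eqVlt => /orP[/eqP lastx | ltx].
    by move: E oy; rewrite lastx modnn => ->.
  by move: E oy; rewrite modn_small // => ->; rewrite /= ox.
by case/orP: cyc => /eqP; apply: succ.
Qed.

Lemma card_chequers m n : #|chequers m n| = (m * n)./2.
Proof.
rewrite -sum1_card big_mkcond /=.
rewrite (eq_bigr (fun u : 'I_n * 'I_m =>
  nat_of_bool (odd ((if odd m then u.1 : nat else 1) + u.2)))); last first.
  by move=> u _; rewrite inE; case: odd.
rewrite -(pair_bigA _ (fun (i : 'I_n) (j : 'I_m) =>
  nat_of_bool (odd ((if odd m then i : nat else 1) + j)))) /=.
(* A path carries [m./2] chosen vertices, and one more exactly when [m] and [i] are both odd. *)
rewrite (eq_bigr (fun i : 'I_n => (m./2 + odd m * odd (0 + i))%N)); last first.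
  by move=> i _; rewrite sum_odd; case: ifP => om; lia.
rewrite big_split /= sum_nat_const card_ord -big_distrr /= sum_odd.
have := odd_double_half m; case: odd => /= <-; last first.
  by rewrite add0n mul0n addn0 -doubleMl !doubleK mulnC.
by rewrite mulnDl mul1n -doubleMl halfD doubleK odd_double andbF /=; lia.
Qed.

Lemma armed_crown_alphas m n : (1 < n)%N ->
  alpha (armed_crown m n) = (m * n)./2 /\
  alpha (line_graph (armed_crown m n)) = (m * n)./2.
Proof.
move=> n1; have lo := leq_card_alpha (chequers_independent m n).
have mate_inj : injective (@crown_mate m n : armed_crown m n -> armed_crown m n).
  exact: crown_mate_inj.
have mid := alpha_le_line_graph mate_inj (fun u => crown_mate_adj u n1).
have := alpha_line_graph_le (armed_crown m n).
move: lo; rewrite card_chequers card_prod !card_ord mulnC => lo hi.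
by split; apply/eqP; rewrite eqn_leq ?lo ?hi ?(leq_trans mid) ?(leq_trans lo).
Qed.

Import GRing.Theory Num.Theory.
Local Open Scope ring_scope.

Theorem theorem2p16 (m n : nat) (hm : (1 <= m)%N) (hn : (3 <= n)%N) :
  let G := armed_crown m n in
  (((alpha G)%:R + (alpha (line_graph G))%:R : rat)
   = (if odd m && odd n
      then (n./2)%:R * ((m%:R + 1) / 2 + 1)
           + (m%:R - 1) / 2 * (n%:R + (uphalf n)%:R)
      else m%:R * n%:R))
  /\
  (((alpha G)%:R * (alpha (line_graph G))%:R : rat)
   = (if odd m && odd n
      then ((n./2)%:R * ((m%:R + 1) / 2) + (uphalf n)%:R * ((m%:R - 1) / 2))
           * ((n./2)%:R + n%:R * ((m%:R - 1) / 2))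
      else n%:R ^+ 2 * m%:R ^+ 2 / 4)).
Proof.
move=> G; have [-> ->] := armed_crown_alphas m (ltnW hn).
case: ifP => [/andP[om on]|omn].
  (* With m = 2a + 1 and n = 2b + 1, both numbers are 2ab + a + b, and the claims become identities
     in a and b. *)
  have Em : m%:R = (m./2)%:R * 2 + 1 :> rat.
    by rewrite -natrM natr1; congr _%:R; lia.
  have En : n%:R = (n./2)%:R * 2 + 1 :> rat.
    by rewrite -natrM natr1; congr _%:R; lia.
  have -> : uphalf n = (n./2 + 1)%N by lia.
  have -> : (m * n)./2 = (m./2 * n./2 * 2 + m./2 + n./2)%N.
    by rewrite -{1}[m]odd_double_half -{1}[n]odd_double_half om on; nia.
  by rewrite !natrD !natrM Em En; split; field.
(* Here mn is even, so the halving is exact. *)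
have two : ((m * n)./2)%:R * 2 = m%:R * n%:R :> rat.
  by rewrite -!natrM muln2 even_halfK // oddM omn.
split; first by rewrite -two; ring.
by rewrite -exprMn [n%:R * _]mulrC -two; field.
Qed.
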